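(* Let $k$ be a (commutative) Noetherian ring and let $A_{|\bullet|}$ be the polynomial ring over the category $\mathsf{Co}$ of cographs, with coefficients in $k$. Let $M$ be an $A_{|\bullet|}$-module. If $M$ is finitely generated, then every $A_{|\bullet|}$-submodule of $M$ is also finitely generated.
   Context: All graphs are finite and simple. The class of cographs is defined inductively: the single vertex is a cograph, and if $G_1,G_2$ are cographs then so are the disjoint union $G_1\sqcup G_2$ and the edge-complements $\overline{G_1},\overline{G_2}$; equivalently, a graph is a cograph if and only if it has no induced subgraph isomorphic to the path $P_4$ on four vertices. A full embedding $G\hookrightarrow G'$ is an injection of vertex sets such that two vertices are adjacent in $G$ if and only if their images are adjacent in $G'$. $\mathsf{Co}$ is the category of cographs and full embeddings. For a ring $k$, a $\mathsf{Co}$-module over $k$ is a functor from $\mathsf{Co}$ to $k$-modules; its images of morphisms are called transition maps. For a cograph $G$ with vertex set $V_G$ put $A_{|G|}=k[x_v \mid v\in V_G]$. The functor $A_{|\bullet|}:\mathsf{Co}\to k\text{-Alg}$ sends $G$ to $A_{|G|}$ and a full embedding $\phi$ to the $k$-algebra map $x_v\mapsto x_{\phi(v)}$. An $A_{|\bullet|}$-module $V$ is a $\mathsf{Co}$-module over $k$ such that each $V_G$ carries the structure of an $A_{|G|}$-module, and for every full embedding $\phi:G\hookrightarrow G'$ and every vertex $v$ of $G$, the transition map $\phi_*:V_G\to V_{G'}$ satisfies $\phi_*(x_v\cdot m)=x_{\phi(v)}\cdot\phi_*(m)$ for all $m \in V_G$. A submodule is a family of $A_{|G|}$-submodules preserved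 by all transition maps. An $A_{|\bullet|}$-module $V$ is finitely generated if each $V_G$ is a finitely generated $A_{|G|}$-module and there is a finite list of cographs $G_1,\ldots,G_n$ such that for every cograph $G$, $V_G$ is generated as an $A_{|G|}$-module by the images of the $V_{G_i}$ under the transition maps. *)

(* Defs.v *)
From HB Require Import structures.
From mathcomp Require Import all_boot all_algebra.
From mathcomp Require Import boolp.
From mathcomp Require Import monalg.

Set Implicit Arguments.
Unset Strict Implicit.
Unset Printing Implicit Defensive.

Import GRing.Theory.
Local Open Scope ring_scope.

Record sgraph := SGraph {
  vertex :> finType;
  adj : rel vertex;
  adj_sym : symmetric adj;
  adj_irr : irreflexive adj
}.
Arguments adj {s}.

Lemma point_sym : symmetric (fun _ _ : unit => false). Proof. by []. Qed.
Lemma point_irr : irreflexive (fun _ _ : unit => false). Proof. by []. Qed.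
Definition point_graph := SGraph point_sym point_irr.

Section GraphOperations.
Variables G H : sgraph.

Definition disj_adj (x y : G + H) : bool :=
  match x, y with
  | inl a, inl b => adj a b
  | inr a, inr b => adj a b
  | _, _ => false
  end.
Lemma disj_sym : symmetric disj_adj.
Proof. by case=> a; case=> b //=; rewrite adj_sym. Qed.
Lemma disj_irr : irreflexive disj_adj.
Proof. by case=> a /=; rewrite adj_irr. Qed.
Definition disj_union := SGraph disj_sym disj_irr.

Definition compl_adj (x y : G) : bool := (x != y) && ~~ adj x y.
Lemma compl_sym : symmetric compl_adj.
Proof. by move=> x y; rewrite /compl_adj eq_sym adj_sym. Qed.
Lemma compl_irr : irreflexive compl_adj.
Proof. by move=> x; rewrite /compl_adj eqxx. Qed.
Definition complement := SGraph compl_sym compl_irr.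

Definition graph_iso : Prop :=
  exists2 f : G -> H, bijective f & {mono f : x y / adj x y}.

End GraphOperations.

(* Cographs are nonempty: the generation starts from a single vertex. *)
Inductive is_cograph : sgraph -> Prop :=
| cograph_point : is_cograph point_graph
| cograph_union G H : is_cograph G -> is_cograph H -> is_cograph (disj_union G H)
| cograph_compl G : is_cograph G -> is_cograph (complement G)
| cograph_iso G H : graph_iso G H -> is_cograph G -> is_cograph H.

Record cograph := Cograph {
  cograph_graph :> sgraph;
  cographP : is_cograph cograph_graph
}.

(* A boolean condition on a finite function, so that embeddings are equal as
   soon as they agree on vertices. *)
Definition is_full_emb (G H : sgraph) (f : {ffun G -> H}) : bool :=
  injectiveb f && [forall x, forall y, adj (f x) (f y) == adj x y].

Record full_emb (G H : sgraph) := FullEmb {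
  emb_fun :> {ffun G -> H};
  embP : is_full_emb emb_fun
}.

HB.instance Definition _ (G H : sgraph) := [isSub for @emb_fun G H].

Lemma emb_id_subproof (G : sgraph) : is_full_emb [ffun x : G => x].
Proof.
apply/andP; split; first by apply/injectiveP => x y; rewrite !ffunE.
by apply/forallP => x; apply/forallP => y; rewrite !ffunE.
Qed.
Definition emb_id (G : sgraph) : full_emb G G := FullEmb (emb_id_subproof G).

Lemma emb_comp_subproof (G H K : sgraph) (g : full_emb H K) (f : full_emb G H) :
  is_full_emb [ffun x => g (f x)].
Proof.
have /andP[/injectiveP ig /forallP mg] := embP g.
have /andP[/injectiveP jf /forallP mf] := embP f.
apply/andP; split.
  by apply/injectiveP => x y; rewrite !ffunE => /ig /jf.
apply/forallP => x; apply/forallP => y; rewrite !ffunE.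
by rewrite (eqP (forallP (mg _) _)) (eqP (forallP (mf _) _)).
Qed.
Definition emb_comp (G H K : sgraph) (g : full_emb H K) (f : full_emb G H) :
  full_emb G K := FullEmb (emb_comp_subproof g f).

Section Modules.
Variables (R : pzRingType) (V : lmodType R).

Record submodule := Submodule {
  submod_set :> V -> Prop;
  submod0 : submod_set 0;
  submodL : forall (a : R) (u v : V),
    submod_set u -> submod_set v -> submod_set (a *: u + v)
}.

(* The predicate is made boolean with classical logic, which is what the
   library needs to equip the subtype with a module structure. *)
Definition submod_mem (W : submodule) : {pred V} := fun v => `[< W v >].

Lemma submod_mem_closed (W : submodule) : submod_closed (submod_mem W).
Proof.
split; first exact/asboolP/submod0.
by move=> a u v /asboolP Wu /asboolP Wv; apply/asboolP/submodL.
Qed.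
HB.instance Definition _ (W : submodule) :=
  GRing.isSubmodClosed.Build R V (submod_mem W) (submod_mem_closed W).

Record submod_of (W : submodule) := SubmodElt {
  submod_val :> V;
  submod_valP : submod_val \in submod_mem W
}.
HB.instance Definition _ (W : submodule) := [isSub for @submod_val W].
HB.instance Definition _ (W : submodule) := [Choice of submod_of W by <:].
HB.instance Definition _ (W : submodule) :=
  [SubChoice_isSubLmodule of submod_of W by <:].

Definition spanned (S : V -> Prop) (v : V) : Prop :=
  exists (n : nat) (a : 'I_n -> R) (g : 'I_n -> V),
    (forall i, S (g i)) /\ v = \sum_(i < n) a i *: g i.

Definition fg_lmod : Prop :=
  exists s : seq V, forall v, spanned (fun g => g \in s) v.

End Modules.

(* Submodules of the regular module k^o are the ideals of k. *)
Definition noetherian (k : comNzRingType) : Prop :=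
  forall I : submodule k^o, fg_lmod (submod_of I).

Definition polyG (k : comNzRingType) (G : sgraph) : comNzRingType :=
  {malg k[{cmonom G}]}.

Definition polyG_const (k : comNzRingType) (G : sgraph) (c : k) : polyG k G :=
  c%:MP.

Definition polyG_var (k : comNzRingType) (G : sgraph) (v : G) : polyG k G :=
  << ucm v >>.
Arguments polyG_const {k} G c.
Arguments polyG_var k {G} v.

(* The k-module structure on [M G] is the restriction of its [polyG k G]-module
   structure to constants. *)
Record Amodule (k : comNzRingType) := MkAmodule {
  Aobj :> forall G : cograph, lmodType (polyG k G);
  Amap : forall G H : cograph, full_emb G H -> Aobj G -> Aobj H;
  Amap_id : forall (G : cograph) (m : Aobj G), Amap (emb_id G) m = m;
  Amap_comp : forall (G H K : cograph) (g : full_emb H K) (f : full_emb G H)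
    (m : Aobj G), Amap (emb_comp g f) m = Amap g (Amap f m);
  Amap_linear : forall (G H : cograph) (f : full_emb G H) (c : k)
    (u v : Aobj G),
    Amap f (polyG_const G c *: u + v) = polyG_const H c *: Amap f u + Amap f v;
  Amap_var : forall (G H : cograph) (f : full_emb G H) (x : G) (m : Aobj G),
    Amap f (polyG_var k x *: m) = polyG_var k (f x) *: Amap f m
}.
Arguments Amap {k} M {G H} f m : rename.

Record Asubmodule (k : comNzRingType) (M : Amodule k) := MkAsubmodule {
  Asub :> forall G : cograph, submodule (M G);
  Asub_map : forall (G H : cograph) (f : full_emb G H) (m : M G),
    Asub G m -> Asub H (Amap M f m)
}.

Section AsubmoduleAsModule.
Variables (k : comNzRingType) (M : Amodule k) (W : Asubmodule M).

Definition Wobj (G : cograph) : lmodType (polyG k G) := submod_of (W G).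

Lemma Wmap_subproof (G H : cograph) (f : full_emb G H) (w : submod_of (W G)) :
  Amap M f (submod_val w) \in submod_mem (W H).
Proof. by apply/asboolP/Asub_map; exact/asboolP/submod_valP. Qed.

Definition Wmap (G H : cograph) (f : full_emb G H) (w : Wobj G) : Wobj H :=
  SubmodElt (Wmap_subproof f w).

Lemma Wmap_id (G : cograph) (w : Wobj G) : Wmap (emb_id G) w = w.
Proof. exact/val_inj/Amap_id. Qed.

Lemma Wmap_comp (G H K : cograph) (g : full_emb H K) (f : full_emb G H)
  (w : Wobj G) : Wmap (emb_comp g f) w = Wmap g (Wmap f w).
Proof. exact/val_inj/Amap_comp. Qed.

Lemma Wmap_linear (G H : cograph) (f : full_emb G H) (c : k) (u v : Wobj G) :
  Wmap f (polyG_const G c *: u + v) = polyG_const H c *: Wmap f u + Wmap f v.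
Proof. exact/val_inj/Amap_linear. Qed.

Lemma Wmap_var (G H : cograph) (f : full_emb G H) (x : G) (w : Wobj G) :
  Wmap f (polyG_var k x *: w) = polyG_var k (f x) *: Wmap f w.
Proof. exact/val_inj/Amap_var. Qed.

Definition Asubmodule_module : Amodule k :=
  MkAmodule Wmap_id Wmap_comp Wmap_linear Wmap_var.

End AsubmoduleAsModule.

Definition fin_gen (k : comNzRingType) (M : Amodule k) : Prop :=
  (forall G : cograph, fg_lmod (M G)) /\
  exists (n : nat) (Gs : 'I_n -> cograph), forall (G : cograph) (m : M G),
    spanned (fun y => exists (i : 'I_n) (f : full_emb (Gs i) G) (u : M (Gs i)),
                        y = Amap M f u) m.

(* Main.v *)
(** Call monomials of M over a cograph G the elements x^a f_*(e_j), where e_j is one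
    of the generators of M and f embeds its cograph in G. A monomial over G is
    encoded as a labelling of the vertices of G by natural numbers. Order the leaves
    of a cotree of each cograph from left to right: labellings of G are then
    well-ordered lexicographically, compatibly with multiplication by variables and
    with embeddings preserving the leaf order, while Kruskal's theorem for binary
    cotrees makes divisibility along such embeddings a well-quasi-order on all
    monomials. If N were not finitely generated, choose inductively v_n in N outside
    the submodule generated by v_0, ..., v_(n-1), with leading monomial as small as
    possible in its own cograph. On a subsequence the leading monomials form a
    divisibility chain; as k is noetherian, some leading coefficient is a
    combination of the earlier ones, so subtracting multiples of images of earlier
    v_i from v_n lowers its leading monomial, contradicting minimality. *)
Require Import Defs.
From mathcomp Require Import all_boot all_algebra.
From mathcomp Require Import finmap boolp monalg.

Set Implicit Arguments.
Unset Strict Implicit.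
Unset Printing Implicit Defensive.

Import GRing.Theory.

(** * Well-quasi-orders *)

Lemma dependent_choice (T : Type) (Q : seq T -> T -> Prop) :
  (forall p, exists x, Q p x) -> exists f : nat -> T, forall n, Q (mkseq f n) (f n).
Proof.
move=> /choice[next Hnext].
pose prefix := fix prefix n := if n is m.+1 then rcons (prefix m) (next (prefix m)) else [::].
exists (fun n => next (prefix n)) => n.
suff -> : mkseq (fun n => next (prefix n)) n = prefix n by [].
by elim: n => // n IHn; rewrite mkseqS IHn.
Qed.

Lemma prop_minimum (T : Type) (m : T -> nat) (P : T -> Prop) x :
  P x -> exists2 y, P y & forall z, P z -> m y <= m z.
Proof.
have [n] := ubnP (m x); elim: n x => // n IHn x ltxn Px.
have [[y [Py lt_yx]]|noy] := EM (exists y, P y /\ m y < m x).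
  by apply: IHn Py; apply: leq_trans lt_yx _.
by exists x => // z Pz; rewrite leqNgt; apply/negP => ?; apply: noy; exists z.
Qed.

Section WellQuasiOrder.
Variable T : Type.
Implicit Types (P : T -> Prop) (R : T -> T -> Prop).

Definition good R (f : nat -> T) := exists i j, i < j /\ R (f i) (f j).

Definition wqo_in P R := forall f, (forall n, P (f n)) -> good R f.

Definition rel_trans R := forall x y z, R x y -> R y z -> R x z.

(** Indices with no later term above them cannot occur arbitrarily far out, as they would index a
    bad sequence. Past some [N] every index thus has a successor with a larger term; iterating the
    choice of successors gives the chain, and transitivity extends it from consecutive terms to all
    pairs. *)
Lemma wqo_chain P R f : wqo_in P R -> rel_trans R -> (forall n, P (f n)) ->
  exists2 g : nat -> nat, {homo g : i j / i < j} &
    forall i j, i < j -> R (f (g i)) (f (g j)).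
Proof.
move=> wR tR Pf.
have [N HN] : exists N, forall i, N <= i -> exists j, i < j /\ R (f i) (f j).
  apply: contrapT => noN.
  have /choice[t Ht] : forall N, exists i, N <= i /\ forall j, i < j -> ~ R (f i) (f j).
    move=> N; apply: contrapT => noi; apply: noN; exists N => i leNi.
    apply: contrapT => noj; apply: noi; exists i; split=> // j ltij Rij.
    by apply: noj; exists j.
  pose h := fix h n := if n is m.+1 then t (h m).+1 else t 0.
  have hterm n j : h n < j -> ~ R (f (h n)) (f j) by case: n => [|n]; apply (Ht _).2.
  have hS n : h n < h n.+1 by apply (Ht _).1.
  have [i [j [ltij Rij]]] := wR (f \o h) (fun n => Pf _).
  by apply: hterm Rij; apply: (homo_ltn ltn_trans hS).
have /choice[s Hs] : forall i, exists j, N <= i -> i < j /\ R (f i) (f j).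
  by move=> i; case: (leqP N i) => [/HN[j Hj]|_]; [exists j|exists 0].
pose g := fix g n := if n is m.+1 then s (g m) else N.
have gN n : N <= g n.
  by elim: n => //= n IHn; apply/ltnW/(leq_ltn_trans IHn); case: (Hs _ IHn).
exists g.
  by apply: (homo_ltn ltn_trans) => n; case: (Hs _ (gN n)).
move=> i j; apply: (@homo_ltn _ (f \o g) R) => [y x z|n]; first exact: tR.
by case: (Hs _ (gN n)).
Qed.

Lemma wqo_and P R1 R2 : wqo_in P R1 -> rel_trans R1 -> wqo_in P R2 ->
  wqo_in P (fun x y => R1 x y /\ R2 x y).
Proof.
move=> w1 t1 w2 f Pf; have [g gm gR] := wqo_chain w1 t1 Pf.
have [i [j [ltij R2ij]]] := w2 (f \o g) (fun n => Pf _).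
by exists (g i), (g j); split; [apply: gm|split=> //; apply: gR].
Qed.

(* Nash-Williams: every term of a bad sequence is made as small as possible
   given the earlier terms. *)
Lemma minimal_bad_sequence (m : T -> nat) R f : ~ good R f ->
  exists2 g, ~ good R g & forall h n, ~ good R h ->
    (forall i, i < n -> h i = g i) -> m (g n) <= m (h n).
Proof.
move=> badf.
(* [ext p]: the list [p] is an initial segment of some bad sequence. [Q] is conditional on it, so
   that every list has a next term, with default [f 0]. *)
pose ext p := exists2 h, ~ good R h & mkseq h (size p) = p.
pose Q p x := ext p -> ext (rcons p x) /\ forall y, ext (rcons p y) -> m x <= m y.
have /dependent_choice[g Hg] : forall p, exists x, Q p x.
  move=> p; case: (EM (ext p)) => [|next]; last by exists (f 0).
  case=> h badh hp.
  have [|x ? ?] := @prop_minimum _ m (fun x => ext (rcons p x)) (h (size p)); last by exists x.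
  by exists h => //; rewrite size_rcons mkseqS hp.
have extg n : ext (mkseq g n).
  elim: n => [|n IHn]; first by exists f.
  by rewrite mkseqS; case: (Hg n).
exists g.
  case=> i [j [ltij Rij]]; case: (extg j.+1) => h badh; rewrite size_mkseq => hg.
  apply: badh; exists i, j; split=> //.
  have hE l : l < j.+1 -> h l = g l.
    by move=> lt; rewrite -(nth_mkseq (f 0) h lt) hg nth_mkseq.
  by rewrite !hE // ltnW.
move=> h n badh hg; case: (Hg n (extg n)) => _; apply.
exists h => //; rewrite size_rcons size_mkseq mkseqS; congr rcons.
by apply/eq_in_map => i; rewrite mem_iota => /hg.
Qed.

End WellQuasiOrder.

Definition wqo (T : Type) (R : T -> T -> Prop) := wqo_in (fun _ : T => True) R.

Lemma wqo_preim (T U : Type) (h : T -> U) (P : U -> Prop) (R : U -> U -> Prop) :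
  wqo_in P R -> wqo_in (fun x => P (h x)) (fun x y => R (h x) (h y)).
Proof. by move=> wR f Pf; apply: (wR (h \o f)). Qed.

Lemma wqo_leq : wqo (fun m n : nat => m <= n).
Proof.
move=> f _; have [n _ fmin] := @prop_minimum nat f (fun=> True) 0 I.
by exists n, n.+1; split=> //; apply: fmin.
Qed.

Lemma wqo_eq (F : finType) : wqo (@eq F).
Proof.
move=> f _; apply: contrapT => badf.
suff /leq_card : injective (fun i : 'I_#|F|.+1 => f i) by rewrite card_ord ltnn.
move=> i j fij; apply: val_inj; case: (ltngtP i j) => // ltij; case: badf.
  by exists i, j.
by exists j, i.
Qed.

Lemma wqo_mod K : 0 < K -> wqo (fun m n => m <= n /\ m = n %[mod K]).
Proof.
case: K => // K _ f _.
pose residue m : 'I_K.+1 := inord (m %% K.+1).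
have wres := wqo_preim (h := residue) (@wqo_eq 'I_K.+1).
have tres : rel_trans (fun m n => residue m = residue n) by move=> x y z -> ->.
have [i [j [ltij [Hmod Hle]]]] := wqo_and wres tres wqo_leq (fun n => I : (fun=> True) (f n)).
exists i, j; do 2!split=> //.
by move/(congr1 val): Hmod; rewrite /= !inordK ?ltn_mod.
Qed.

(** * Kruskal's theorem for binary cotrees *)

Inductive cotree (L : Type) := Leaf of L | Node of bool & cotree L & cotree L.
Arguments Leaf {L}.
Arguments Node {L}.

Fixpoint cotree_size L (t : cotree L) :=
  if t is Node _ t1 t2 then (cotree_size t1 + cotree_size t2).+1 else 0.

Definition cotree_child L (s t : cotree L) : Prop :=
  if t is Node _ t1 t2 then s = t1 \/ s = t2 else False.

Lemma cotree_child_size L (s t : cotree L) :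
  cotree_child s t -> cotree_size s < cotree_size t.
Proof. by case: t => //= b t1 t2 [] ->; rewrite ltnS ?leq_addr ?leq_addl. Qed.

(** Nash-Williams' argument. [R] is any transitive relation closed under the embedding rules, so
    that it can be instantiated with [lg_le] on the graphs of cotrees. *)
Lemma kruskal_cotree L (RL : L -> L -> Prop) (R : cotree L -> cotree L -> Prop) :
  wqo RL -> rel_trans R ->
  (forall a b, RL a b -> R (Leaf a) (Leaf b)) ->
  (forall s t u, R s t -> cotree_child t u -> R s u) ->
  (forall b s1 s2 t1 t2, R s1 t1 -> R s2 t2 -> R (Node b s1 s2) (Node b t1 t2)) ->
  wqo R.
Proof.
move=> wL tR Rleaf Rchild Rnode f _; apply: contrapT.
move=> /(minimal_bad_sequence (@cotree_size L))[{}f badf minf].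
have wchild : wqo_in (fun s => exists n, cotree_child s (f n)) R.
  move=> h /choice[k hk]; apply: contrapT => badh.
  (* Here [h n] is a child of [f (k n)]. The sequence [g] follows [f] before the least host index
     [k n0], then [h] from [n0] on. It is still bad, because a term below a child is below its
     parent, yet its term at [k n0] is smaller than that of [f]. *)
  have [n0 _ minn0] := @prop_minimum nat k (fun=> True) 0 I.
  pose g i := if i < k n0 then f i else h (i - k n0 + n0).
  suff badg : ~ good R g.
    have : cotree_size (f (k n0)) <= cotree_size (g (k n0)).
      by apply: minf => // i lti; rewrite /g lti.
    by rewrite /g ltnn subnn leqNgt => /negP[]; apply: cotree_child_size.
  case=> i [j [ltij]]; rewrite /g; case: (ltnP i) => lti; case: (ltnP j) => ltj.
  - by move=> Rij; apply: badf; exists i, j.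
  - move=> /Rchild/(_ (hk _)) Rij; apply: badf; exists i, (k (j - k n0 + n0)).
    by split=> //; apply: leq_trans lti (minn0 _ I).
  - by move: (leq_trans (leq_trans ltj lti) (ltnW ltij)); rewrite ltnn.
  - move=> Rij; apply: badh; exists (i - k n0 + n0), (j - k n0 + n0); split=> //.
    by rewrite ltn_add2r ltn_sub2r // (leq_ltn_trans lti).
(* On a subsequence the roots are all leaves, or all nodes with the same bit. *)
pose tag (t : cotree L) := if t is Node b _ _ then Some b else None.
have [g gm gtag] : exists2 g : nat -> nat, {homo g : i j / i < j} &
    forall i j, i < j -> tag (f (g i)) = tag (f (g j)).
  have wtag := wqo_preim (h := tag) (@wqo_eq (option bool)).
  have ttag : rel_trans (fun s t => tag s = tag t) by move=> x y z -> ->.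
  by apply: (wqo_chain wtag ttag).
have badfg : ~ good R (f \o g).
  by case=> i [j [ltij Rij]]; apply: badf; exists (g i), (g j); split=> //; apply: gm.
case E0: (f (g 0)) (gtag 0) => [a0|b t0 t0'] /= tag0.
  have /choice[l Hl] : forall n, exists a, f (g n) = Leaf a.
    case=> [|n]; first by exists a0.
    by move: (tag0 n.+1 isT); case: (f _) => // a _; exists a.
  have [i [j [ltij Rij]]] := wL l (fun=> I).
  by apply: badfg; exists i, j; split=> //=; rewrite !Hl; apply: Rleaf.
have /choice[l Hl] : forall n, exists s, f (g n) = Node b s.1 s.2.
  case=> [|n]; first by exists (t0, t0').
  by move: (tag0 n.+1 isT); case: (f _) => // _ s1 s2 [<-]; exists (s1, s2).
(* Left and right children are both well-quasi-ordered, hence so are pairs of children, and one pair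
   of terms compares on both sides at once. *)
pose P s := exists n, cotree_child s (f n).
have w1 : wqo_in (fun s => P s.1 /\ P s.2) (fun s t => R s.1 t.1).
  by move=> h Ph; apply: (wchild (fst \o h)) => n; case: (Ph n).
have w2 : wqo_in (fun s => P s.1 /\ P s.2) (fun s t => R s.2 t.2).
  by move=> h Ph; apply: (wchild (snd \o h)) => n; case: (Ph n).
have t1 : rel_trans (fun s t : cotree L * cotree L => R s.1 t.1).
  by move=> x y z; apply: tR.
have [n|i [j [ltij [R1 R2]]]] := @wqo_and _ _ _ _ w1 t1 w2 l.
  by split; exists (g n); rewrite Hl /=; [left|right].
by apply: badfg; exists i, j; split=> //=; rewrite !Hl; apply: Rnode.
Qed.

(** * Labelled cographs *)

Section SumGraph.
Variables (b : bool) (G H : sgraph).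

(** The disjoint union for [b = false], the join for [b = true]; with both, cotrees need no
    complement nodes. *)
Definition sum_adj (x y : G + H) : bool :=
  match x, y with
  | inl u, inl v => adj u v
  | inr u, inr v => adj u v
  | _, _ => b
  end.

Lemma sum_sym : symmetric sum_adj.
Proof. by case=> u [] v //=; rewrite adj_sym. Qed.

Lemma sum_irr : irreflexive sum_adj.
Proof. by case=> u /=; rewrite adj_irr. Qed.

Definition sum_graph := SGraph sum_sym sum_irr.

End SumGraph.

Record lgraph := LGraph {
  lg_graph :> sgraph;
  lg_order : seq lg_graph;
  lg_label : lg_graph -> nat
}.
Arguments LGraph : clear implicits.

Definition lg_point a := LGraph point_graph [:: tt] (fun=> a).

Definition lg_sum b (A B : lgraph) :=
  LGraph (sum_graph b A B) (map inl (lg_order A) ++ map inr (lg_order B))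
    (fun x => match x with inl u => lg_label u | inr v => lg_label v end).

Definition lg_compl (A : lgraph) := LGraph (complement A) (lg_order A) (@lg_label A).

Fixpoint cotree_lgraph (t : cotree nat) : lgraph :=
  match t with
  | Leaf a => lg_point a
  | Node b t1 t2 => lg_sum b (cotree_lgraph t1) (cotree_lgraph t2)
  end.

(** De Morgan duality: complementation exchanges unions and joins and fixes the single vertex. *)
Fixpoint cotree_compl (t : cotree nat) : cotree nat :=
  match t with
  | Leaf a => Leaf a
  | Node b t1 t2 => Node (~~ b) (cotree_compl t1) (cotree_compl t2)
  end.

Section LabelledEmbedding.
Variable RL : nat -> nat -> Prop.
Hypothesis RLxx : forall a, RL a a.
Hypothesis RL_trans : rel_trans RL.

Definition lg_le (A B : lgraph) := exists phi : A -> B,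
  [/\ injective phi, {mono phi : x y / adj x y},
      subseq (map phi (lg_order A)) (lg_order B) &
      forall v, RL (lg_label v) (lg_label (phi v))].

(** Mutual embeddability stands in for isomorphism; it suffices for transferring comparisons between
    graphs and cotrees. *)
Definition lg_equiv A B := lg_le A B /\ lg_le B A.

Lemma lg_le_trans : rel_trans lg_le.
Proof.
move=> A B C [f [If mf sf lf]] [g [Ig mg sg lg]]; exists (g \o f); split.
- exact: inj_comp.
- by move=> x y /=; rewrite mg mf.
- by apply: subseq_trans sg; rewrite map_comp; apply: map_subseq.
- by move=> v; apply: RL_trans (lg _).
Qed.

Lemma lg_equiv_trans : rel_trans lg_equiv.
Proof. by move=> A B C [? ?] [? ?]; split; apply: lg_le_trans; eassumption. Qed.

Lemma lg_le_sum b A1 A2 B1 B2 :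
  lg_le A1 B1 -> lg_le A2 B2 -> lg_le (lg_sum b A1 A2) (lg_sum b B1 B2).
Proof.
move=> [f [If mf sf lf]] [g [Ig mg sg lg]].
exists (fun x => match x with inl u => inl (f u) | inr v => inr (g v) end); split.
- by move=> [x|x] [y|y] // [] => [/If|/Ig] ->.
- by case=> x [] y //=.
- rewrite map_cat -!map_comp; apply: cat_subseq.
    by rewrite (eq_map (g := inl \o f)) // map_comp map_subseq.
  by rewrite (eq_map (g := inr \o g)) // map_comp map_subseq.
- by case.
Qed.

Lemma lg_le_inl b A B1 B2 : lg_le A B1 -> lg_le A (lg_sum b B1 B2).
Proof.
move=> [f [If mf sf lf]]; exists (inl \o f); split=> //.
  by move=> x y [/If].
by rewrite map_comp; apply: subseq_trans (prefix_subseq _ _); apply: map_subseq.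
Qed.

Lemma lg_le_inr b A B1 B2 : lg_le A B2 -> lg_le A (lg_sum b B1 B2).
Proof.
move=> [f [If mf sf lf]]; exists (inr \o f); split=> //.
  by move=> x y [/If].
by rewrite map_comp; apply: subseq_trans (suffix_subseq _ _); apply: map_subseq.
Qed.

Lemma lg_le_compl A B : lg_le A B -> lg_le (lg_compl A) (lg_compl B).
Proof.
move=> [f [If mf sf lf]]; exists f; split=> // x y.
by rewrite /= /compl_adj (inj_eq If) mf.
Qed.

Lemma lg_equiv_sum b A1 A2 B1 B2 :
  lg_equiv A1 B1 -> lg_equiv A2 B2 -> lg_equiv (lg_sum b A1 A2) (lg_sum b B1 B2).
Proof. by move=> [? ?] [? ?]; split; apply: lg_le_sum. Qed.

Lemma lg_equiv_eq (G : sgraph) (adj' : rel G) (sym' : symmetric adj') (irr' : irreflexive adj')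
    (s : seq G) w w' :
  adj =2 adj' -> w =1 w' -> lg_equiv (LGraph G s w) (LGraph (SGraph sym' irr') s w').
Proof.
move=> eq_adj eq_w.
by split; exists id; split=> //; rewrite /= ?map_id //= => v; rewrite eq_w.
Qed.

Lemma lg_equiv_compl_sum b A B :
  lg_equiv (lg_compl (lg_sum b A B)) (lg_sum (~~ b) (lg_compl A) (lg_compl B)).
Proof. by apply: lg_equiv_eq => [[x|x] [y|y]|[x|x]]. Qed.

Lemma lg_equiv_compl_cotree t :
  lg_equiv (lg_compl (cotree_lgraph t)) (cotree_lgraph (cotree_compl t)).
Proof.
elim: t => [a|b t1 IH1 t2 IH2] /=.
  by apply: lg_equiv_eq => [[] []|[]].
by apply: lg_equiv_trans (lg_equiv_compl_sum _ _ _) _; apply: lg_equiv_sum.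
Qed.

(** The order [s] is quantified before the labelling: it must serve all monomials over [G] at
    once. *)
Definition cotree_ordered (G : sgraph) (s : seq G) :=
  [/\ uniq s, forall x, x \in s &
      forall w, exists t, lg_equiv (LGraph G s w) (cotree_lgraph t)].

Lemma cograph_cotree_ordered G : is_cograph G -> exists s, @cotree_ordered G s.
Proof.
elim=> {G} [|G H _ [s [us ms ts]] _ [s' [us' ms' ts']]|G _ [s [us ms ts]]|].
- exists [:: tt]; split=> //.
  by move=> w; exists (Leaf (w tt)); apply: lg_equiv_eq => [[] []|[]].
- exists (map inl s ++ map inr s'); split.
  + rewrite cat_uniq !map_inj_uniq ?us ?us' ?andbT //=; try by move=> x y [].
    by apply/hasPn => x /mapP[y _ ->]; apply/mapP => -[].
  + by case=> x; rewrite mem_cat map_f ?orbT.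
  + move=> w; have [t Ht] := ts (w \o inl); have [t' Ht'] := ts' (w \o inr).
    exists (Node false t t'); apply: lg_equiv_trans (lg_equiv_sum false Ht Ht').
    by apply: lg_equiv_eq => [[x|x] [y|y]|[x|x]].
- exists s; split=> // w; have [t [tl tr]] := ts w.
  exists (cotree_compl t); apply: lg_equiv_trans (lg_equiv_compl_cotree t).
  by split; [apply: (lg_le_compl tl)|apply: (lg_le_compl tr)].
- move=> G H [f [g fK gK] mf] _ [s [us ms ts]]; exists (map f s); split.
  + by rewrite map_inj_uniq //; apply: can_inj fK.
  + by move=> x; rewrite -(gK x) map_f.
  + move=> w; have [t Ht] := ts (w \o f); exists t; apply: lg_equiv_trans Ht.
    split.
      exists g; split=> //=; first exact: can_inj gK.
      * by move=> x y; rewrite -mf !gK.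
      * by rewrite -map_comp (eq_map fK) map_id.
      * by move=> v; rewrite gK.
    by exists f; split=> //=; apply: can_inj fK.
Qed.

Lemma wqo_lgraph : wqo RL -> wqo_in (fun A : lgraph => cotree_ordered (lg_order A)) lg_le.
Proof.
move=> wRL f Pf.
have /choice[t Ht] : forall n, exists t, lg_equiv (f n) (cotree_lgraph t).
  by move=> n; case: (Pf n) => _ _ /(_ (@lg_label (f n))); case: (f n).
have wt : wqo (fun s t => lg_le (cotree_lgraph s) (cotree_lgraph t)).
  apply: kruskal_cotree wRL _ _ _ _ => /=.
  - by move=> ? ? ?; apply: lg_le_trans.
  - by move=> a b Rab; exists id; split=> //; move=> ? ?.
  - by move=> s u [] // b u1 u2 le_su [] <-; [apply: lg_le_inl|apply: lg_le_inr].
  - by move=> *; apply: lg_le_sum.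
have [i [j [ltij le_ij]]] := wt t (fun=> I).
exists i, j; split=> //; apply: lg_le_trans (Ht i).1 _.
exact: lg_le_trans le_ij (Ht j).2.
Qed.

End LabelledEmbedding.

(** * Lexicographic order on labellings *)

Section Push.
Variables (X Y : finType) (phi : X -> Y).
Implicit Types w : X -> nat.

(** For injective [phi] this is extension by zero. In general it is the exponent vector after the
    substitution of [phi x] for [x]. *)
Definition push w (y : Y) := \sum_(x | phi x == y) w x.

Lemma push_out w y : (forall x, phi x != y) -> push w y = 0.
Proof. by move=> out; rewrite /push big_pred0 // => x; apply/negbTE. Qed.

Lemma push_img w x : injective phi -> push w (phi x) = w x.
Proof. by move=> Iphi; rewrite /push (big_pred1 x) // => z; apply: inj_eq. Qed.

Lemma pushD w1 w2 y : push (fun x => w1 x + w2 x) y = push w1 y + push w2 y.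
Proof. exact: big_split. Qed.

Lemma pushM c w y : push (fun x => c * w x) y = c * push w y.
Proof. by rewrite /push big_distrr. Qed.

End Push.

Lemma push_id (X : finType) (phi : X -> X) (w : X -> nat) : phi =1 id -> push phi w =1 w.
Proof.
by move=> phiE x; rewrite -{1}[x]phiE push_img // => y z; rewrite !phiE.
Qed.

Lemma push_comp (X Y Z : finType) (f : X -> Y) (g : Y -> Z) (w : X -> nat) :
  push g (push f w) =1 push (g \o f) w.
Proof.
move=> z; rewrite /push [RHS](partition_big f (fun y => g y == z)) //=.
apply: eq_bigr => y /eqP <-; apply: eq_bigl => x.
by case: (f x =P y) => [->|_]; rewrite ?eqxx ?andbF.
Qed.

Lemma eq_push (X Y : finType) (f g : X -> Y) (w w' : X -> nat) :
  f =1 g -> w =1 w' -> push f w =1 push g w'.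
Proof. by move=> eqf eqw y; apply: eq_big => x; rewrite ?eqf. Qed.

Section Lexicographic.
Variable X : eqType.
Implicit Types (s : seq X) (w : X -> nat).

Fixpoint lexs s w w' : bool :=
  if s is x :: s' then (w x < w' x) || (w x == w' x) && lexs s' w w' else false.

(** Induction on the list, then on the value at its head, then on accessibility for the tail. *)
Lemma lexs_wf s : well_founded (lexs s).
Proof.
elim: s => [|x s IHs] w; first by constructor.
have [n] := ubnP (w x); elim: n w => [|n IHn] w; first by rewrite ltn0.
elim: {w}(IHs w) => w _ IHw ltwn; constructor=> w' /orP[ltw|/andP[/eqP eqw lexw]].
  by apply: IHn; apply: leq_trans ltw _.
by apply: IHw; rewrite ?eqw.
Qed.

Lemma lexs_irr s w : lexs s w w = false.
Proof. by elim: s => //= x s ->; rewrite ltnn andbF. Qed.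

Lemma lexs_trans s : transitive (lexs s).
Proof.
elim: s => //= x s IHs w2 w1 w3.
case: (ltngtP (w1 x) (w2 x)) => //= [lt12 _|->]; last first.
  by case: ltngtP => //= _; apply: IHs.
by case/orP=> [lt23|/andP[/eqP <- _]]; rewrite ?lt12 // (ltn_trans lt12).
Qed.

Lemma lexs_total s w w' : [\/ lexs s w w', lexs s w' w | {in s, w =1 w'}].
Proof.
elim: s => [|x s IHs] /=; first by constructor 3.
case: (ltngtP (w x) (w' x)) => /= [_|_|eqx]; [by constructor 1|by constructor 2|].
case: IHs => [->|->|eqs]; [by constructor 1|by constructor 2|constructor 3].
by move=> y; rewrite inE => /predU1P[->|/eqs].
Qed.

Lemma eq_lexs s w1 w1' w2 w2' : w1 =1 w2 -> w1' =1 w2' -> lexs s w1 w1' = lexs s w2 w2'.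
Proof. by move=> eq1 eq2; elim: s => //= x s ->; rewrite eq1 eq2. Qed.

Lemma lexsD s w w' u : lexs s (fun x => w x + u x) (fun x => w' x + u x) = lexs s w w'.
Proof. by elim: s => //= x s ->; rewrite ltn_add2r eqn_add2r. Qed.

Lemma lexs_filter (a : pred X) s w w' : {in [predC a], w =1 w'} ->
  lexs s w w' = lexs (filter a s) w w'.
Proof.
move=> eqw; elim: s => //= x s ->.
case: ifP => // /negbT ax; by rewrite eqw // ltnn eqxx.
Qed.

End Lexicographic.

Lemma lexs_map (X Y : eqType) (phi : X -> Y) s w w' :
  lexs (map phi s) w w' = lexs s (w \o phi) (w' \o phi).
Proof. by elim: s => //= x s ->. Qed.

(** Both pushed labellings vanish off the image of [phi], so only image positions matter in [s']; by
    the subsequence hypothesis these are [map phi s], in that order. *)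
Lemma lexs_push (X Y : finType) (phi : X -> Y) s s' w w' :
  injective phi -> (forall x, x \in s) -> uniq s' -> subseq (map phi s) s' ->
  lexs s w w' -> lexs s' (push phi w) (push phi w').
Proof.
move=> Iphi memS us' /(subseq_uniqP us') def_s lex_w.
rewrite (@lexs_filter _ [in map phi s]) => [|y].
  by rewrite -def_s lexs_map (eq_lexs _ (w2 := w) (w2' := w')) // => x /=; rewrite push_img.
rewrite inE => /= out_y; have out x : phi x != y.
  by apply: contraNneq out_y => <-; apply: map_f.
by rewrite !push_out.
Qed.

(** * Spans and polynomials *)

Local Open Scope ring_scope.

Section Span.
Variables (R : pzRingType) (V : lmodType R).
Implicit Types (S : V -> Prop) (u v : V).

Lemma spanned0 S : spanned S 0.
Proof.
exists 0, (fun=> 0), (fun=> 0); split; first by case.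
by rewrite big_ord0.
Qed.

Lemma spannedDl S a u v : S u -> spanned S v -> spanned S (a *: u + v).
Proof.
move=> Su [n [b [g [Sg ->]]]].
exists n.+1, (fun i => if unlift ord0 i is Some j then b j else a),
  (fun i => if unlift ord0 i is Some j then g j else u); split.
  by move=> i; case: unliftP.
by rewrite big_ord_recl unlift_none; under [in RHS]eq_bigr do rewrite liftK.
Qed.

Lemma spanned_gen S u : S u -> spanned S u.
Proof. by move=> Su; rewrite -[u]addr0 -[u]scale1r; apply: spannedDl (spanned0 S). Qed.

Lemma spanned_elim S (P : V -> Prop) : P 0 ->
  (forall a u v, S u -> P v -> P (a *: u + v)) -> forall v, spanned S v -> P v.
Proof.
move=> P0 PD v [n [a [g [Sg ->]]]].
elim: n a g Sg => [|n IHn] a g Sg; first by rewrite big_ord0.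
by rewrite big_ord_recl; apply: PD => //; apply: IHn.
Qed.

Lemma spannedD S u v : spanned S u -> spanned S v -> spanned S (u + v).
Proof.
move=> Su Sv; elim/spanned_elim: u / Su => [|a u u' Su IHu]; first by rewrite add0r.
by rewrite -addrA; apply: spannedDl.
Qed.

Lemma spannedZ S a v : spanned S v -> spanned S (a *: v).
Proof.
elim/spanned_elim=> [|b u v' Su IHv]; first by rewrite scaler0; apply: spanned0.
by rewrite scalerDr scalerA; apply: spannedDl.
Qed.

Lemma spanned_sum S (I : Type) (r : seq I) (F : I -> V) :
  (forall i, spanned S (F i)) -> spanned S (\sum_(i <- r) F i).
Proof.
by move=> SF; apply: big_ind => //; [apply: spanned0|apply: spannedD].
Qed.

Lemma spanned_trans S S' v :
  (forall u, S u -> spanned S' u) -> spanned S v -> spanned S' v.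
Proof.
move=> SS'; elim/spanned_elim=> [|a u v' Su IHv]; first exact: spanned0.
by apply: spannedD => //; apply/spannedZ/SS'.
Qed.

Lemma spannedS S S' v : (forall u, S u -> S' u) -> spanned S v -> spanned S' v.
Proof. by move=> SS'; apply: spanned_trans => u /SS'; apply: spanned_gen. Qed.

Lemma submod_val0 (W : submodule V) : submod_val (0 : submod_of W) = 0.
Proof. exact: (raddf0 (val : submod_of W -> V)). Qed.

Lemma submod_valL (W : submodule V) a (u v : submod_of W) :
  submod_val (a *: u + v) = a *: submod_val u + submod_val v.
Proof. exact: (linearP (val : submod_of W -> V)). Qed.

Lemma submod_valB (W : submodule V) (u v : submod_of W) :
  submod_val (u - v) = submod_val u - submod_val v.
Proof. exact: (raddfB (val : submod_of W -> V)). Qed.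

Lemma submod_valZ (W : submodule V) a (u : submod_of W) :
  submod_val (a *: u) = a *: submod_val u.
Proof. by rewrite -[a *: u]addr0 submod_valL submod_val0 addr0. Qed.

Lemma submod_val_sum (W : submodule V) (I : Type) (r : seq I) (F : I -> submod_of W) :
  submod_val (\sum_(i <- r) F i) = \sum_(i <- r) submod_val (F i).
Proof. exact: (raddf_sum (val : submod_of W -> V)). Qed.

End Span.

(** The ideal generated by all [c i] has finitely many generators, which involve only the [c i] with
    [i < n] for some [n]; then [c n] is a combination of those. *)
Lemma noetherian_sequence (k : comNzRingType) (c : nat -> k) : noetherian k ->
  exists r (b : nat -> k), c r = \sum_(i < r) b i * c i.
Proof.
move=> hk.
pose below n (u : k^o) := exists2 i, (i < n)%N & u = c i.
pose I (x : k^o) := exists n, spanned (below n) x.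
have belowS m n x : (m <= n)%N -> spanned (below m) x -> spanned (below n) x.
  by move=> lemn; apply: spannedS => u [i lti ->]; exists i => //; apply: leq_trans lemn.
have I0 : I 0 by exists 0; apply: spanned0.
have IL a u v : I u -> I v -> I (a *: u + v).
  move=> [m Hm] [n Hn]; exists (maxn m n); apply: spannedD; first apply: spannedZ.
    by apply: belowS Hm; apply: leq_maxl.
  by apply: belowS Hn; apply: leq_maxr.
have [gens Hgens] := hk (Submodule I0 IL).
have [n Hn] : exists n, forall g, g \in gens -> spanned (below n) (submod_val g).
  elim: {Hgens} gens => [|g s [n Hn]]; first by exists 0.
  have [m Hm] : I (submod_val g) := asboolW (submod_valP g).
  exists (maxn m n) => h; rewrite inE => /predU1P[->|/Hn Hh].
    by apply: belowS Hm; apply: leq_maxl.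
  by apply: belowS Hh; apply: leq_maxr.
have cI : c n \in submod_mem (Submodule I0 IL).
  by apply/asboolP; exists n.+1; apply: spanned_gen; exists n.
have Hc : spanned (below n) (c n).
  pose P (x : submod_of (Submodule I0 IL)) := spanned (below n) (submod_val x).
  suff: P (SubmodElt cI) by [].
  apply: spanned_elim (Hgens _) => [|a u v gu Hv].
    by rewrite /P submod_val0; apply: spanned0.
  by rewrite /P submod_valL; apply: spannedD Hv; apply/spannedZ/Hn.
(* A span may list its generators in any order and with repetitions; coefficients of the same [c i]
   are collected here. *)
pose comb (x : k^o) := exists b : nat -> k, x = \sum_(i < n) b i * c i.
exists n; suff: comb (c n) by [].
apply: spanned_elim Hc => [|a _ v [i lti ->] [b ->]].
  by exists (fun=> 0); rewrite big1 // => i _; rewrite mul0r.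
exists (fun l => (if l == i then a else 0) + b l).
under [RHS]eq_bigr do rewrite mulrDl; rewrite big_split /=; congr (_ + _).
rewrite (bigD1 (Ordinal lti)) //= eqxx big1 ?addr0 // => l neqli.
by rewrite ifN ?mul0r.
Qed.

Lemma prod_push (R : comNzRingType) (X Y : finType) (f : X -> Y) (a : X -> nat) (z : Y -> R) :
  \prod_x z (f x) ^+ a x = \prod_y z y ^+ push f a y.
Proof.
rewrite (partition_big f xpredT) //=; apply: eq_bigr => y _.
by rewrite /push -prodrXr; apply: eq_bigr => x /eqP ->.
Qed.

(** * Monomial expansion of polynomials *)

Section Polynomials.
Variables (k : comNzRingType) (G : sgraph).
Implicit Types (a b : G -> nat).

Definition polyG_mon a : polyG k G := \prod_x polyG_var k x ^+ a x.

Lemma polyG_mon0 : polyG_mon (fun=> 0) = 1.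
Proof. exact: big1. Qed.

Lemma polyG_monD a b : polyG_mon (fun x => (a x + b x)%N) = polyG_mon a * polyG_mon b.
Proof. by rewrite -big_split; apply: eq_bigr => x _; rewrite exprD. Qed.

Lemma eq_polyG_mon a b : a =1 b -> polyG_mon a = polyG_mon b.
Proof. by move=> eqab; apply: eq_bigr => x _; rewrite eqab. Qed.

Lemma polyG_const1 : polyG_const G (1 : k) = 1.
Proof. exact: mpolyC1E. Qed.

Lemma polyG_const0 : polyG_const G (0 : k) = 0.
Proof. exact: monalgU0. Qed.

Lemma polyG_constD (c d : k) : polyG_const G (c + d) = polyG_const G c + polyG_const G d.
Proof. exact: monalgUD. Qed.

Lemma polyG_constM (c d : k) : polyG_const G (c * d) = polyG_const G c * polyG_const G d.
Proof. exact: mpolyCM. Qed.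

Lemma polyG_constN (c : k) : polyG_const G (- c) = - polyG_const G c.
Proof. exact: monalgUN. Qed.

Lemma polyG_const_sum (I : Type) (r : seq I) (F : I -> k) :
  polyG_const G (\sum_(i <- r) F i) = \sum_(i <- r) polyG_const G (F i).
Proof. exact: raddf_sum. Qed.

(** Transition maps are specified on constants and variables only, so basis monomials must be
    written as products of powers of variables. *)
Lemma malgU_mon (m : {cmonom G}) : << m >> = polyG_mon (fun x => m x).
Proof.
have Umul (m1 m2 : {cmonom G}) : << mmul m1 m2 >> = << m1 >> * << m2 >> :> polyG k G.
  by rewrite malgM_def fgmulUU mulr1.
pose pow x n : {cmonom G} := iter n (mmul (ucm x)) mone.
have Upow x n : << pow x n >> = polyG_var k x ^+ n.
  by elim: n => [|n IHn] //=; rewrite Umul IHn exprS.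
have powE x n y : pow x n y = ((x == y) * n)%N.
  elim: n => [|n IHn]; first by rewrite muln0 /= cm1.
  by rewrite /= cmM cmU IHn mulnS.
rewrite {1}(_ : m = \big[mmul/mone]_x pow x (m x)); last first.
  apply/eqP/cmP => y; rewrite (big_morph (fun m : {cmonom G} => m y) (cmM y) (cm1 y)).
  rewrite (bigD1 y) //= powE eqxx mul1n big1 ?addn0 // => x /negbTE neqxy.
  by rewrite powE neqxy.
rewrite (big_morph (fun m => << m >> : polyG k G) Umul (erefl _)).
by apply: eq_bigr => x _; rewrite Upow.
Qed.

Lemma polyG_sum_mon (p : polyG k G) :
  p = \sum_(m <- msupp p) polyG_const G p@_m * polyG_mon (fun x => (m : {cmonom G}) x).
Proof.
rewrite [LHS]monalgE; apply: eq_bigr => m _.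
by rewrite -malgU_mon malgM_def fgmulUU mul1m mulr1.
Qed.

End Polynomials.

Section Amodules.
Variables (k : comNzRingType) (M : Amodule k).
Implicit Types (G H : cograph).

Lemma AmapD G H (f : full_emb G H) (u v : M G) : Amap M f (u + v) = Amap M f u + Amap M f v.
Proof. by have := Amap_linear f 1 u v; rewrite !polyG_const1 !scale1r. Qed.

Lemma Amap0 G H (f : full_emb G H) : Amap M f 0 = 0.
Proof. by apply: (addrI (Amap M f 0)); rewrite -AmapD !addr0. Qed.

Lemma AmapB_const G H (f : full_emb G H) (c : k) (u v : M G) :
  Amap M f (u - polyG_const G c *: v) = Amap M f u - polyG_const H c *: Amap M f v.
Proof.
by rewrite addrC -scaleNr -polyG_constN Amap_linear polyG_constN scaleNr addrC.
Qed.

Lemma Amap_mon G H (f : full_emb G H) (a : G -> nat) (m : M G) :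
  Amap M f (polyG_mon k a *: m) = polyG_mon k (push f a) *: Amap M f m.
Proof.
rewrite {2}/polyG_mon -prod_push.
rewrite /polyG_mon; elim/big_rec2: _ => [|x p q _ IH]; first by rewrite !scale1r.
rewrite -!scalerA -IH; elim: (a x) => [|n IHn]; first by rewrite !expr0 !scale1r.
by rewrite !exprS -!scalerA Amap_var IHn.
Qed.

(** [q] is [p] with its variables renamed along [f]; it does not depend on [m]. *)
Lemma AmapZ G H (f : full_emb G H) (p : polyG k G) :
  exists q : polyG k H, forall m, Amap M f (p *: m) = q *: Amap M f m.
Proof.
exists (\sum_(a <- msupp p) polyG_const H p@_a * polyG_mon k (push f (a : {cmonom G}))) => m.
rewrite {1}[p]polyG_sum_mon !scaler_suml (big_morph _ (AmapD f) (Amap0 f)).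
apply: eq_bigr => a _; rewrite -!scalerA -Amap_mon -[_ *: _]addr0 Amap_linear.
by rewrite Amap0 addr0.
Qed.

End Amodules.

Section ConstantSpan.
Variables (k : comNzRingType).

(** The span over [k], with scalars embedded as constant polynomials; leading terms are taken in
    such combinations of monomials. *)
Inductive kspan (G : sgraph) (V : lmodType (polyG k G)) (S : V -> Prop) : V -> Prop :=
| kspan0 : kspan S 0
| kspanDl c u v : S u -> kspan S v -> kspan S (polyG_const G c *: u + v).

Lemma kspan_map (G H : sgraph) (V : lmodType (polyG k G)) (W : lmodType (polyG k H))
    (S : V -> Prop) (S' : W -> Prop) (F : V -> W) v :
  F 0 = 0 -> (forall c u u', F (polyG_const G c *: u + u') = polyG_const H c *: F u + F u') ->
  (forall u, S u -> S' (F u)) -> kspan S v -> kspan S' (F v).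
Proof.
move=> F0 FD FS; elim=> {v} [|c u v Su _ IHv]; first by rewrite F0; apply: kspan0.
by rewrite FD; apply: kspanDl => //; apply: FS.
Qed.

Variables (G : sgraph) (V : lmodType (polyG k G)).
Implicit Types (S : V -> Prop) (u v : V).

Lemma kspanS S S' v : (forall u, S u -> S' u) -> kspan S v -> kspan S' v.
Proof. by move=> SS'; apply: (kspan_map (F := id)). Qed.

Lemma kspanD S u v : kspan S u -> kspan S v -> kspan S (u + v).
Proof.
move=> Su Sv; elim: Su => [|c w u' Sw _ IH]; first by rewrite add0r.
by rewrite -addrA; apply: kspanDl.
Qed.

Lemma kspanZ S c v : kspan S v -> kspan S (polyG_const G c *: v).
Proof.
elim=> {v} [|d u v Su _ IH]; first by rewrite scaler0; apply: kspan0.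
by rewrite scalerDr scalerA -polyG_constM; apply: kspanDl.
Qed.

Lemma kspanB S u v : kspan S u -> kspan S v -> kspan S (u - v).
Proof.
move=> Su Sv; apply: kspanD => //; rewrite -[v]scale1r -scaleNr -polyG_const1 -polyG_constN.
exact: kspanZ.
Qed.

Lemma kspan_sum S (I : Type) (r : seq I) (F : I -> V) :
  (forall i, kspan S (F i)) -> kspan S (\sum_(i <- r) F i).
Proof. by move=> SF; apply: big_ind => //; [apply: kspan0|apply: kspanD]. Qed.

End ConstantSpan.

(** * Monomials of a finitely generated module *)

Lemma cograph_inhabited G : is_cograph G -> inhabited G.
Proof.
elim=> {G} [|G H _ [x] _ _|G _ [x]|G H [f _ _] _ [x]]; constructor.
- exact: tt.
- exact: (inl x).
- exact: x.
- exact: (f x).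
Qed.

Section FullEmbeddings.
Variables (G H : sgraph) (f : full_emb G H).

Lemma emb_inj : injective f.
Proof. by have /andP[/injectiveP] := embP f. Qed.

Lemma emb_ext (g : full_emb G H) : f =1 g -> f = g.
Proof. by move=> eqfg; apply/val_inj/ffunP. Qed.

End FullEmbeddings.

Lemma emb_of_fun (G H : sgraph) (f : G -> H) :
  injective f -> {mono f : x y / adj x y} -> exists g : full_emb G H, g =1 f.
Proof.
move=> If mf; suff Hf : is_full_emb [ffun x => f x].
  by exists (FullEmb Hf) => x; rewrite /= ffunE.
apply/andP; split; first by apply/injectiveP => x y; rewrite !ffunE => /If.
by apply/forallP => x; apply/forallP => y; rewrite !ffunE mf.
Qed.

Definition at_graph (k : comNzRingType) (M : Amodule k) (G : cograph) (v : M G) :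
    {G : cograph & M G} := existT (fun G : cograph => M G : Type) G v.

Definition generated (k : comNzRingType) (M : Amodule k) (J : Type)
    (g : J -> {G : cograph & M G}) (G : cograph) (v : M G) : Prop :=
  spanned (fun y => exists j (f : full_emb (tag (g j)) G), y = Amap M f (tagged (g j))) v.

(** The equation [g j = x] is a hypothesis so that [f] need not be transported along it by the
    caller. *)
Lemma generated_map (k : comNzRingType) (M : Amodule k) (J : Type)
    (g : J -> {G : cograph & M G}) j (x : {G : cograph & M G}) (G : cograph)
    (f : full_emb (tag x) G) :
  g j = x -> generated g (Amap M f (tagged x)).
Proof. by move=> gj; case: x / gj in f *; apply: spanned_gen; exists j, f. Qed.

Section Monomials.
Variables (k : comNzRingType) (M : Amodule k) (J : finType) (g : J -> {G : cograph & M G}).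

Definition mark : finType := {j : J & tag (g j)}.

(** Distinct vertices of distinct generators get distinct codes. The successor reserves 0 for
    vertices outside the embedded generator. *)
Definition mark_code j (x : tag (g j)) : nat :=
  (enum_rank (Tagged (fun j => tag (g j) : Type) x : mark)).+1.

Definition nmarks := #|mark|.+1.

(* [w] encodes the monomial [m]: its residues modulo [nmarks] record the
   embedding of the generator, its quotients record the exponents. *)
Definition monomial (G : cograph) (w : G -> nat) (m : M G) : Prop :=
  exists j (f : full_emb (tag (g j)) G) (a : G -> nat),
    m = polyG_mon k a *: Amap M f (tagged (g j)) /\
    w = fun v => (nmarks * a v + push f (@mark_code j) v)%N.

Lemma mark_code_inj i j (x : tag (g i)) (y : tag (g j)) :
  mark_code x = mark_code y ->
  Tagged (fun j => tag (g j) : Type) x = Tagged (fun j => tag (g j) : Type) y.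
Proof. by move=> [] /val_inj/enum_rank_inj. Qed.

Lemma push_mark_lt (G : sgraph) j (f : tag (g j) -> G) v :
  injective f -> (push f (@mark_code j) v < nmarks)%N.
Proof.
move=> If; have [[x /eqP <-]|nox] := EM (exists x, f x == v).
  by rewrite push_img // ltnS ltn_ord.
by rewrite push_out // => x; apply/negP => fx; apply: nox; exists x.
Qed.

Lemma push_mark_modn (G : sgraph) j (f : tag (g j) -> G) (a : G -> nat) v :
  injective f ->
  ((nmarks * a v + push f (@mark_code j) v) %% nmarks)%N = push f (@mark_code j) v.
Proof. by move=> If; rewrite mulnC modnMDl modn_small // push_mark_lt. Qed.

Lemma monomial_shift (G H : cograph) (f : full_emb G H) (b : H -> nat) w m :
  monomial w m ->
  monomial (fun y => (nmarks * b y + push f w y)%N) (polyG_mon k b *: Amap M f m).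
Proof.
move=> [j [h [a [-> ->]]]].
exists j, (emb_comp f h), (fun y => (b y + push f a y)%N); split.
  by rewrite polyG_monD -scalerA Amap_mon Amap_comp.
apply/funext => y; rewrite pushD pushM push_comp mulnDr -addnA; congr (_ + (_ + _))%N.
by apply: eq_push => // x; rewrite /= ffunE.
Qed.

(** Equal residues force both monomials to come from the same generator, with embeddings compatible
    with [f]. The inequality of labels then becomes one of exponents, and [b] is the difference. *)
Lemma monomial_divides (G H : cograph) (f : full_emb G H) w m w' m' :
  monomial w m -> monomial w' m' ->
  (forall v, (w v <= w' (f v))%N /\ w v = w' (f v) %[mod nmarks]) ->
  exists b, w' = (fun y => (nmarks * b y + push f w y)%N) /\
            m' = polyG_mon k b *: Amap M f m.
Proof.
move=> [j [h [a [-> ->]]]] [j' [h' [a' [-> ->]]]] le_ww'.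
have /= markE v : push h (@mark_code j) v = push h' (@mark_code j') (f v).
  by have [_] := le_ww' v; rewrite !push_mark_modn //; apply: emb_inj.
(* The mark at [h x] is nonzero, so [f (h x)] must lie in the image of [h']. *)
have fibre x : exists2 x', h' x' = f (h x) &
    Tagged (fun j => tag (g j) : Type) x = Tagged (fun j => tag (g j) : Type) x'.
  have := markE (h x); rewrite push_img; last exact: emb_inj.
  have [[x' /eqP <-]|nox] := EM (exists x', h' x' == f (h x)).
    by rewrite push_img => [/mark_code_inj|]; [exists x'|apply: emb_inj].
  by rewrite push_out // => x'; apply/negP => fx; apply: nox; exists x'.
(* Cographs are nonempty, and a single mark already identifies the generator. *)
have [x0] := cograph_inhabited (cographP (tag (g j))).
have [_ _ /(congr1 tag)/= eqj] := fibre x0; case: _ / eqj in h' fibre markE le_ww' *.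
have {fibre} def_h' : h' = emb_comp f h.
  apply: emb_ext => x; rewrite ffunE; have [x' hx' eqx] := fibre x.
  by move: hx'; rewrite -(eq_from_Tagged eqx).
have le_a y : (push f a y <= a' y)%N.
  have [[v /eqP <-]|nov] := EM (exists v, f v == y); last first.
    by rewrite push_out // => v; apply/negP => fv; apply: nov; exists v.
  rewrite push_img; last exact: emb_inj.
  by have [] := le_ww' v; rewrite markE leq_add2r leq_pmul2l.
exists (fun y => (a' y - push f a y)%N); split.
  apply/funext => y; rewrite pushD pushM push_comp addnA -mulnDr subnK //.
  by congr (_ + _)%N; apply: eq_push => // x; rewrite def_h' ffunE.
rewrite Amap_mon scalerA -polyG_monD def_h' Amap_comp; congr (_ *: _).
by apply: eq_polyG_mon => y; rewrite subnK.
Qed.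

(** Divisibility along the identity embedding, where the quotient exponent [b] must vanish. *)
Lemma monomial_fun (G : cograph) w (m m' : M G) : monomial w m -> monomial w m' -> m = m'.
Proof.
move=> mon_m mon_m'.
have idE : emb_id G =1 id by move=> x; rewrite ffunE.
have [|b [wE ->]] := monomial_divides (f := emb_id G) mon_m mon_m'.
  by move=> v; rewrite idE.
rewrite Amap_id (@eq_polyG_mon k G _ (fun=> 0%N)) ?polyG_mon0 ?scale1r // => y.
have := congr1 (fun w => w y) wE; rewrite push_id // => /eqP.
by rewrite -[X in X == _]add0n eqn_add2r eq_sym muln_eq0 => /eqP.
Qed.

Definition mspan (G : cograph) (Q : (G -> nat) -> Prop) : M G -> Prop :=
  kspan (fun m => exists2 w, Q w & monomial w m).

Lemma mspan_shift (G H : cograph) (f : full_emb G H) (b : H -> nat)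
    (Q : (G -> nat) -> Prop) (Q' : (H -> nat) -> Prop) (v : M G) :
  (forall w, Q w -> Q' (fun y => (nmarks * b y + push f w y)%N)) ->
  mspan Q v -> mspan Q' (polyG_mon k b *: Amap M f v).
Proof.
move=> QQ'; apply: (kspan_map (F := fun v => polyG_mon k b *: Amap M f v)).
- by rewrite Amap0 scaler0.
- by move=> c u u'; rewrite Amap_linear scalerDr !scalerA [_ * polyG_mon k b]mulrC.
- move=> u [w Qw mon_u]; exists (fun y => (nmarks * b y + push f w y)%N); first exact: QQ'.
  exact: monomial_shift.
Qed.

Lemma mspan_generated (G : cograph) (v : M G) : generated g v -> mspan (fun=> True) v.
Proof.
apply: spanned_elim => [|p _ {}v [j [f ->]] IHv]; first exact: kspan0.
apply: kspanD IHv; rewrite [p]polyG_sum_mon scaler_suml; apply: kspan_sum => m.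
rewrite -scalerA; apply/kspanZ; rewrite -[_ *: _]addr0 -[_ *: _]scale1r -polyG_const1.
apply: kspanDl; last exact: kspan0.
exists (fun v => (nmarks * (m : {cmonom G}) v + push f (@mark_code j) v)%N) => //.
by exists j, f, m.
Qed.

End Monomials.

(** * Noetherianity *)

Section Leading.
Variables (k : comNzRingType) (M : Amodule k) (J : finType) (g : J -> {G : cograph & M G}).
Hypothesis gen_g : forall G v, @generated k M J g G v.
Implicit Types (G : cograph).

Definition mark_rel (a b : nat) := (a <= b)%N /\ a = b %[mod nmarks g].

Lemma mark_rel_refl a : mark_rel a a.
Proof. by []. Qed.

Lemma mark_rel_trans : rel_trans mark_rel.
Proof. by move=> a b c [ab eab] [bc ebc]; split; [apply: leq_trans bc|rewrite eab]. Qed.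

Lemma cograph_order (G : cograph) : {s : seq G | cotree_ordered mark_rel s}.
Proof. exact/cid/(cograph_cotree_ordered mark_rel_refl mark_rel_trans)/cographP. Qed.

Definition corder G : seq G := sval (cograph_order G).

Lemma corderP G : cotree_ordered mark_rel (corder G).
Proof. exact: (svalP (cograph_order G)). Qed.

Lemma corder_total G (w w' : G -> nat) :
  [\/ lexs (corder G) w w', lexs (corder G) w' w | w = w'].
Proof.
have [_ memc _] := corderP G.
case: (lexs_total (corder G) w w') => [?|?|eqw]; [by constructor 1|by constructor 2|].
by constructor 3; apply/funext => x; apply: eqw.
Qed.

Definition below G (w : G -> nat) : M G -> Prop := mspan g (fun w' => lexs (corder G) w' w).
Definition upto G (w : G -> nat) : M G -> Prop := mspan g (fun w' => ~~ lexs (corder G) w w').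

Lemma upto_trans G (w w' : G -> nat) v : ~~ lexs (corder G) w' w -> upto w v -> upto w' v.
Proof.
move=> nlt; apply: kspanS => m [w1 nlt1 mon]; exists w1 => //.
apply: contra nlt => lt1; case: (corder_total w1 w) => [lt|lt|<-//].
  exact: lexs_trans lt.
by rewrite lt in nlt1.
Qed.

(** [w] is the largest label in one given expression of [v]; cancellation may make it larger than
    necessary. *)
Lemma mspan_upto G (Q : (G -> nat) -> Prop) v :
  mspan g Q v -> v = 0 \/ exists2 w, Q w & upto w v.
Proof.
elim=> {v} [|c u v [w Qw mon] _ IHv]; first by left.
have upto_u : upto w (polyG_const G c *: u).
  rewrite -[_ *: _]addr0; apply: kspanDl; last exact: kspan0.
  by exists w => //; rewrite lexs_irr.
right; case: IHv => [->|[w' Qw' upto_v]]; first by exists w; rewrite ?addr0.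
have [lt|nlt] := boolP (lexs (corder G) w w').
  exists w' => //; apply: kspanD upto_v; apply: upto_trans upto_u.
  by apply/negP => /(lexs_trans lt); rewrite lexs_irr.
by exists w => //; apply: kspanD upto_u _; apply: upto_trans upto_v.
Qed.

(** All terms labelled [w] are multiples of one element by [monomial_fun], so their coefficients add
    up to [c]. *)
Lemma upto_below G (w : G -> nat) v : upto w v ->
  below w v \/ exists m c, monomial g w m /\ below w (v - polyG_const G c *: m).
Proof.
move=> upto_v; have [[m mon_m]|nomon] := EM (exists m, monomial g w m); last first.
  left; apply: kspanS upto_v => m [w' nlt mon]; exists w' => //.
  case: (corder_total w w') => [lt|//|eqw]; first by rewrite lt in nlt.
  by case: nomon; exists m; rewrite eqw.
right; exists m; elim: upto_v => {v} [|c u v [w' nlt mon] _ [d [_ IHv]]].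
  by exists 0; split=> //; rewrite polyG_const0 scale0r subr0; apply: kspan0.
case: (corder_total w w') => [lt|lt|eqw]; first by rewrite lt in nlt.
  by exists d; split=> //; rewrite -addrA; apply: kspanDl => //; exists w'.
exists (c + d); split; first exact: mon_m.
rewrite -eqw in mon; rewrite polyG_constD scalerDl (monomial_fun mon mon_m) opprD addrACA.
by rewrite subrr add0r.
Qed.

Lemma lexs_minimum G (P : (G -> nat) -> Prop) w : P w ->
  exists2 w0, P w0 & forall w', lexs (corder G) w' w0 -> ~ P w'.
Proof.
elim: {w}(lexs_wf (corder G) w) => w _ IHw Pw.
have [[w' [lt Pw']]|nolt] := EM (exists w', lexs (corder G) w' w /\ P w').
  exact: IHw lt Pw'.
by exists w => // w' lt Pw'; apply: nolt; exists w'.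
Qed.

Variable N : Asubmodule M.
Let W := Asubmodule_module N.

Record lead := Lead {
  lead_graph : cograph;
  lead_elt : W lead_graph;
  lead_code : lead_graph -> nat;
  lead_coef : k;
  lead_mon : M lead_graph
}.

Definition lead_gen (x : lead) : {G : cograph & W G} := at_graph (lead_elt x).

Definition is_lead (x : lead) :=
  monomial g (@lead_code x) (lead_mon x) /\
  below (@lead_code x) (submod_val (lead_elt x) - polyG_const _ (lead_coef x) *: lead_mon x).

(** Among labels over one fixed [G] bounding some element outside the generated submodule, a minimal
    one is taken. Anything strictly below it is then generated, so the chosen element has a term at
    that label. *)
Lemma minimal_lead (I : Type) (h : I -> {G : cograph & W G}) :
  ~ (forall G (v : W G), generated h v) ->
  exists x, [/\ is_lead x, ~ generated h (lead_elt x) &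
    forall v : W (lead_graph x), below (@lead_code x) (submod_val v) -> generated h v].
Proof.
move=> /existsNP[G /existsNP[v0 ngen0]].
pose P w := exists2 v : W G, ~ generated h v & upto w (submod_val v).
have Pspan Q (v : W G) : ~ generated h v -> mspan g Q (submod_val v) -> exists2 w, Q w & P w.
  move=> ngen /mspan_upto[v_eq0|[w Qw up]]; last by exists w => //; exists v.
  by case: ngen; rewrite (_ : v = 0); [apply: spanned0|apply: val_inj; rewrite [RHS]submod_val0].
have [w _ Pw] := Pspan _ _ ngen0 (mspan_generated (gen_g _)).
have [{Pw}w0 [v ngen up] minw0] := lexs_minimum Pw.
have gen_below (v' : W G) : below w0 (submod_val v') -> generated h v'.
  by move=> bel; apply: contrapT => ngen'; have [w' /minw0] := Pspan _ _ ngen' bel.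
have [/gen_below //|[m [c [mon bel]]]] := upto_below up.
by exists (Lead v w0 c m).
Qed.

Lemma submodule_generated : noetherian k ->
  exists n (h : 'I_n -> {G : cograph & W G}), forall G (v : W G), generated h v.
Proof.
move=> hk; apply: contrapT => infgen.
(* The empty family yields a first element, which serves as the default of [nth]. *)
pose h0 (i : 'I_0) : {G : cograph & W G} := False_rect _ (notF (ltn_ord i)).
have [x0 _] : exists x, _ := minimal_lead (fun gen => infgen (ex_intro _ 0%N (ex_intro _ h0 gen))).
pose prev (p : seq lead) (i : 'I_(size p)) := lead_gen (nth x0 p i).
have /dependent_choice[f Hf] : forall p, exists x,
  [/\ is_lead x, ~ generated (@prev p) (lead_elt x) &
    forall v : W (lead_graph x), below (@lead_code x) (submod_val v) -> generated (@prev p) v].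
  by move=> p; apply: minimal_lead => gen; apply: infgen; exists (size p), (@prev p).
pose lg n := LGraph (lead_graph (f n)) (corder _) (@lead_code (f n)).
have wlg := wqo_lgraph mark_rel_trans (wqo_mod (isT : (0 < nmarks g)%N)).
have lgP n : cotree_ordered mark_rel (lg_order (lg n)) by apply: corderP.
have [s s_mono s_le] := wqo_chain wlg (lg_le_trans mark_rel_trans) lgP.
have [r [b cr]] := noetherian_sequence (fun i => lead_coef (f (s i))) hk.
have [[mon_r below_r] ngen_r gen_r] := Hf (s r).
set G := lead_graph (f (s r)) in mon_r below_r ngen_r gen_r.
(* [u i] is the image of the earlier element of index [s i], shifted so that its leading monomial
   becomes that of the element of index [s r]. *)
have /choice[u Hu] : forall i : 'I_r, exists u : W G, generated (@prev (mkseq f (s r))) u /\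
    below (@lead_code (f (s r)))
      (submod_val u - polyG_const G (lead_coef (f (s i))) *: lead_mon (f (s r))).
  move=> i; have [phi [phi_inj phi_adj phi_ord phi_lab]] := s_le i r (ltn_ord i).
  have [[mon_i below_i] _ _] := Hf (s i).
  have [e eE] := emb_of_fun phi_inj phi_adj.
  have [|a [codeE monE]] := monomial_divides (f := e) mon_i mon_r.
    by move=> v; rewrite eE; apply: phi_lab.
  have lts : (s i < size (mkseq f (s r)))%N by rewrite size_mkseq s_mono.
  pose v := lead_elt (f (s i)).
  exists (polyG_mon k a *: Amap W e v); split.
    apply/spannedZ/(@generated_map _ _ _ _ (Ordinal lts) (lead_gen (f (s i)))).
    by rewrite /prev nth_mkseq // s_mono.
  have -> : submod_val (polyG_mon k a *: Amap W e v) -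
      polyG_const G (lead_coef (f (s i))) *: lead_mon (f (s r)) =
    polyG_mon k a *: Amap M e (submod_val v -
      polyG_const _ (lead_coef (f (s i))) *: lead_mon (f (s i))).
    rewrite AmapB_const submod_valZ scalerBr monE !scalerA.
    by rewrite [_ * polyG_mon k a]mulrC.
  (* Embeddings preserving the leaf order and products with a monomial are strictly monotone, so
     lower terms stay lower. *)
  apply: mspan_shift below_i => w' ltw'; rewrite codeE.
  rewrite (eq_lexs _ (fun y => addnC _ _) (fun y => addnC _ _)) lexsD.
  have [[_ memc _] [uniqc _ _]] := (corderP (lead_graph (f (s i))), corderP G).
  apply: lexs_push ltw' => //; first exact: emb_inj.
  by rewrite (eq_map eE).
pose x := \sum_(i < r) polyG_const G (b i) *: u i.
have gen_x : generated (@prev (mkseq f (s r))) x.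
  by apply: spanned_sum => i; apply/spannedZ/(Hu i).1.
(* By the choice of the [b i], subtracting [x] cancels the leading term; minimality makes the
   remainder generated, hence also the element itself. *)
apply: ngen_r; rewrite -[lead_elt _](subrK x); apply: spannedD gen_x; apply: gen_r.
pose y i := submod_val (u i) - polyG_const G (lead_coef (f (s i))) *: lead_mon (f (s r)).
have -> : submod_val (lead_elt (f (s r)) - x) =
    submod_val (lead_elt (f (s r))) - polyG_const G (lead_coef (f (s r))) *: lead_mon (f (s r)) -
    \sum_(i < r) polyG_const G (b i) *: y i.
  rewrite submod_valB submod_val_sum cr polyG_const_sum scaler_suml.
  rewrite -addrA -opprD -big_split /=; congr (_ - _); apply: eq_bigr => i _.
  apply: etrans (submod_valZ _ _) _; rewrite polyG_constM -scalerA -scalerDr.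
  by rewrite addrC subrK.
by apply: kspanB => //; apply: kspan_sum => i; apply/kspanZ/(Hu i).2.
Qed.

End Leading.

(** * Finite generation through finite families of elements *)

Lemma fin_gen_generated (k : comNzRingType) (M : Amodule k) : fin_gen M ->
  exists (J : finType) (g : J -> {G : cograph & M G}), forall G (v : M G), generated g v.
Proof.
move=> [fgM [n [Gs genM]]].
have gens i : {s : seq (M (Gs i)) | forall v, spanned (fun x => x \in s) v} := cid (fgM (Gs i)).
pose J : finType := {i : 'I_n & 'I_(size (sval (gens i)))}.
pose g (j : J) : {G : cograph & M G} :=
  at_graph (tnth (in_tuple (sval (gens (tag j)))) (tagged j)).
exists J, g => G v.
apply: spanned_trans (genM G v) => _ [i [f [u ->]]].
pose P u := generated g (Amap M f u).
apply: (spanned_elim (P := P)) (svalP (gens i) u) => [|p u' v' u's IHv]; rewrite /P.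
  by rewrite Amap0; apply: spanned0.
have [q AmapE] := AmapZ M f p; rewrite AmapD AmapE; apply: spannedD IHv; apply: spannedZ.
have ltu : (index u' (sval (gens i)) < size (sval (gens i)))%N by rewrite index_mem.
apply: (@generated_map _ _ _ _ (Tagged _ (Ordinal ltu)) (at_graph u')).
by rewrite /g (tnth_nth u') /= nth_index.
Qed.

(** Finite generation over each [G] holds because each generator has only finitely many embeddings
    into [G]. *)
Lemma generated_fin_gen (k : comNzRingType) (M : Amodule k) n (g : 'I_n -> {G : cograph & M G}) :
  (forall G (v : M G), generated g v) -> fin_gen M.
Proof.
move=> gen_g; split=> [G|]; last first.
  exists n, (fun i => tag (g i)) => G v; apply: spannedS (gen_g G v).
  by move=> _ [i [f ->]]; exists i, f, (tagged (g i)).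
(* All finite functions are enumerated; those that are not full embeddings contribute the harmless
   value 0. *)
pose imgs i : seq (M G) :=
  [seq if insub h is Some f then Amap M (f : full_emb _ _) (tagged (g i)) else 0
     | h <- enum {ffun tag (g i) -> G}].
exists (flatten [seq imgs i | i <- enum 'I_n]) => v; apply: spannedS (gen_g G v).
move=> _ [i [f ->]]; apply/flatten_mapP; exists i; first by rewrite mem_enum.
by apply/mapP; exists (val f); rewrite ?mem_enum ?valK.
Qed.

Theorem theorem1 (k : comNzRingType) (hk : noetherian k) (M : Amodule k)
    (hM : fin_gen M) (N : Asubmodule M) :
  fin_gen (Asubmodule_module N).
Proof.
have [J [g gen_g]] := fin_gen_generated hM.
have [n [h gen_h]] := submodule_generated gen_g N hk.
exact: generated_fin_gen gen_h.
Qed.
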